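(* Let $M$ be a complete Riemannian manifold, $Z$ a smooth vector field on $M$, and $P_t$ the minimal semigroup generated by $\mathcal A=\frac12\Delta+Z$. Let $f\in C_b^2(M)$, $x\in M$, $u,v\in T_xM$, $t\ge0$, and set $f_s:=P_{t-s}f$ for $s\in[0,t]$. If the local martingale $$N'_s(u,v):=(\nabla df_s)(W_s(u),W_s(v))+(df_s)(W'_s(u,v)),\qquad 0\le s\le t,$$ is a martingale, then $$(\nabla dP_tf)(u,v)=\mathbb E\big[(\nabla df)(W_t(u),W_t(v))+(df)(W'_t(u,v))\big].$$
   Context: $M$ is connected, with Levi-Civita connection $\nabla$, Laplace–Beltrami operator $\Delta$; $\nabla df$ is the Hessian. $C_b^2(M)$: $C^2$ functions bounded together with their first two covariant derivatives. Curvature: $R(X,Y)=\nabla_X\nabla_Y-\nabla_Y\nabla_X-\nabla_{[X,Y]}$, $\mathrm{Ric}(X,Y)=\sum_i\langle R(X,e_i)e_i,Y\rangle$, $\langle\mathrm{Ric}^\sharp(v),w\rangle=\mathrm{Ric}(v,w)$, $\mathrm{Ric}_Z^\sharp(v):=\mathrm{Ric}^\sharp(v)-2\nabla_vZ$, $(\nabla\mathrm{Ric}_Z^\sharp)(v_1,v_2):=(\nabla_{v_1}\mathrm{Ric}_Z^\sharp)(v_2)$, $(d^\star R)(v_1,v_2):=-\sum_i(\nabla_{e_i}R)(e_i,v_1)v_2$, $R(Z)(v_1,v_2):=R(Z,v_1)v_2$. For $x\in M$, $X(x)$ is a diffusion started at $x$ with generator $\mathcal A$ and explosion time $\zeta(x)$,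 and $P_tf(x)=\mathbb E[\mathbf 1_{\{t<\zeta(x)\}}f(X_t(x))]$. $//_s:T_xM\to T_{X_s(x)}M$ is stochastic parallel transport along $X(x)$, $D=//\,d\,//^{-1}$ is the covariant (Itô) differential, and $B$ is the Brownian motion on $T_xM$ driving $X(x)$, i.e. $\circ dX_s=//_s\circ dB_s+Z(X_s)\,ds$ (Stratonovich). $W_s:T_xM\to T_{X_s(x)}M$ solves $$DW_s(u)=-\tfrac12\mathrm{Ric}_Z^\sharp W_s(u)\,ds,\quad W_0(u)=u,$$ and $W'_s(u,v)\in T_{X_s(x)}M$ solves the covariant Itô equation $$DW'_s(u,v)=R(//_sdB_s,W_s(u))W_s(v)-\tfrac12\big(d^\star R-2R(Z)+\nabla\mathrm{Ric}_Z^\sharp\big)(W_s(u),W_s(v))\,ds-\tfrac12\mathrm{Ric}_Z^\sharp(W'_s(u,v))\,ds,\quad W'_0(u,v)=0 .$$ These processes are defined up to the explosion time; the hypothesis that $N'(u,v)$ is a martingale on $[0,t]$ includes that $X(x)$ does not explode by time $t$. *)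

(* Defs.v *)
From HB Require Import structures.
From mathcomp Require Import all_boot all_order all_algebra.
From mathcomp Require Import all_classical all_reals all_analysis.
From mathcomp Require Import lra.
Set Implicit Arguments.
Unset Strict Implicit.
Unset Printing Implicit Defensive.
Import Order.TTheory GRing.Theory Num.Theory.
Import numFieldNormedType.Exports.
Local Open Scope classical_set_scope.
Local Open Scope ring_scope.

Section calculus.
Context {R : realType} {n : nat}.
Implicit Types (O : set 'rV[R]_n) (f : 'rV[R]_n -> R) (y : 'rV[R]_n).

Definition partial (i : 'I_n) f y : R := 'D_(delta_mx 0 i) f y.

Fixpoint Ck (k : nat) O f : Prop :=
  (forall y, O y -> {for y, continuous f}) /\
  if k is k'.+1 then
    forall i, (forall y, O y -> derivable f y (delta_mx 0 i)) /\
              Ck k' O (partial i f)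
  else True.

Definition smooth O f : Prop := forall k, Ck k O f.

Definition smooth_mx m1 m2 O (F : 'rV[R]_n -> 'M[R]_(m1, m2)) : Prop :=
  forall i j, smooth O (fun y => F y i j).

End calculus.

(* [G] is the matrix of the metric in a coordinate domain; vectors are rows,
   covectors are columns.  Tensors are evaluated on vectors by extending these
   to vector fields with constant components. *)

Section local_geometry.
Context {R : realType} {n : nat} (G : 'rV[R]_n -> 'M[R]_n).
Implicit Types (a b c d y : 'rV[R]_n) (X Y V : 'rV[R]_n -> 'rV[R]_n).

Definition ddir a (f : 'rV[R]_n -> R) y : R := \sum_i a 0 i * partial i f y.

(* Gamma_{ij}^k of the Levi-Civita connection, see [christoffel_torsion_free]
   and [christoffel_metric] *)
Definition christoffel y (i j k : 'I_n) : R :=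
  2^-1 * \sum_l invmx (G y) k l *
    (partial i (fun z => G z j l) y + partial j (fun z => G z i l) y
     - partial l (fun z => G z i j) y).

Definition nabla X V y : 'rV[R]_n :=
  \row_k (ddir (X y) (fun z => V z 0 k) y
          + \sum_i \sum_j christoffel y i j k * X y 0 i * V y 0 j).

Definition lie X Y y : 'rV[R]_n :=
  \row_k (ddir (X y) (fun z => Y z 0 k) y - ddir (Y y) (fun z => X z 0 k) y).

Definition curvature X Y V y : 'rV[R]_n :=
  nabla X (nabla Y V) y - nabla Y (nabla X V) y - nabla (lie X Y) V y.

Definition lcurv y a b c : 'rV[R]_n := curvature (cst a) (cst b) (cst c) y.

Definition linner y a b : R := (a *m G y *m b^T) 0 0.

Let dx (i : 'I_n) : 'rV[R]_n := delta_mx 0 i.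

(* sum_i T(e_i, e_i) over an orthonormal basis e, computed in the coordinate
   basis for bilinear T; see [mtraceE] *)
Definition mtrace (E : lmodType R) y (T : 'rV[R]_n -> 'rV[R]_n -> E) : E :=
  \sum_i \sum_j invmx (G y) i j *: T (dx i) (dx j).

Definition lric y a b : R :=
  mtrace (E := R^o) y (fun e e' => linner y (lcurv y a e e') b).

(* index raising: <Ric# a, b> = Ric(a, b) *)
Definition lric_sharp y a : 'rV[R]_n :=
  (\row_j lric y a (dx j)) *m invmx (G y).

Definition lricZ_sharp (Z : 'rV[R]_n -> 'rV[R]_n) y a : 'rV[R]_n :=
  lric_sharp y a - 2 *: nabla (cst a) Z y.

(* (nabla_a alpha)(b) for a 1-form alpha *)
Definition cov_form (al : 'rV[R]_n -> 'cV[R]_n) y a b : R :=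
  ddir a (fun z => (b *m al z) 0 0) y
  - (nabla (cst a) (cst b) y *m al y) 0 0.

(* (nabla_a A)(b) for a field A of endomorphisms *)
Definition cov_end (A : 'rV[R]_n -> 'rV[R]_n -> 'rV[R]_n) y a b : 'rV[R]_n :=
  nabla (cst a) (fun z => A z b) y - A y (nabla (cst a) (cst b) y).

(* (nabla_a R)(b, c) d *)
Definition cov_curv y a b c d : 'rV[R]_n :=
  nabla (cst a) (fun z => lcurv z b c d) y
  - lcurv y (nabla (cst a) (cst b) y) c d
  - lcurv y b (nabla (cst a) (cst c) y) d
  - lcurv y b c (nabla (cst a) (cst d) y).

Definition ldstarR y a b : 'rV[R]_n :=
  - mtrace y (fun e e' => cov_curv y e e' a b).

Lemma mtraceE (E : lmodType R) y (T : 'rV[R]_n -> 'rV[R]_n -> E)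
    (e : 'M[R]_n) :
    (forall k a b c, T (k *: a + b) c = k *: T a c + T b c) ->
    (forall k a b c, T a (k *: b + c) = k *: T a b + T a c) ->
    e *m G y *m e^T = 1%:M ->
  mtrace y T = \sum_i T (row i e) (row i e).
Proof.
move=> Tl Tr eG.
have T0l c : T 0 c = 0.
  by have := Tl (-1) 0 0 c; rewrite scaler0 addr0 scaleN1r addNr.
have T0r a : T a 0 = 0.
  by have := Tr (-1) a 0 0; rewrite scaler0 addr0 scaleN1r addNr.
have Tsl (h : 'I_n -> 'rV[R]_n) (k : 'I_n -> R) c :
    T (\sum_i k i *: h i) c = \sum_i k i *: T (h i) c.
  have TD : {morph T^~ c : u v / u + v}.
    by move=> u v; have := Tl 1 u v c; rewrite !scale1r.
  rewrite (big_morph (T^~ c) TD (T0l c)); apply: eq_bigr => i _.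
  by rewrite -[_ *: h i]addr0 Tl T0l addr0.
have Tsr (h : 'I_n -> 'rV[R]_n) (k : 'I_n -> R) a :
    T a (\sum_i k i *: h i) = \sum_i k i *: T a (h i).
  have TD : {morph T a : u v / u + v}.
    by move=> u v; have := Tr 1 a u v; rewrite !scale1r.
  rewrite (big_morph (T a) TD (T0r a)); apply: eq_bigr => i _.
  by rewrite -[_ *: h i]addr0 Tr T0r addr0.
have eU : e \in unitmx.
  by move: eG; rewrite -mulmxA => /mulmx1_unit[].
have -> : mtrace y T = \sum_i \sum_j (e^T *m e) i j *: T (dx i) (dx j).
  have tU : e^T \in unitmx by rewrite unitmx_tr.
  have GE : G y = invmx e *m invmx e^T.
    apply: (can_inj (mulKmx eU)); rewrite mulmxA mulmxV// mul1mx.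
    by apply: (can_inj (mulmxK tU)); rewrite mulVmx.
  suff -> : e^T *m e = invmx (G y) by [].
  have VG : (e^T *m e) *m G y = 1%:M.
    by rewrite GE mulmxA -(mulmxA e^T) mulmxV// mulmx1 mulmxV.
  have [_ GU] := mulmx1_unit VG.
  by apply: (can_inj (mulmxK GU)); rewrite VG mulVmx.
transitivity (\sum_k \sum_i \sum_j (e k i * e k j) *: T (dx i) (dx j)).
  rewrite [RHS]exchange_big; apply: eq_bigr => i _ /=.
  rewrite [RHS]exchange_big; apply: eq_bigr => j _ /=.
  rewrite mxE scaler_suml; apply: eq_bigr => k _.
  by rewrite mxE.
apply: eq_bigr => k _.
rewrite (row_sum_delta (row k e)) Tsl; apply: eq_bigr => i _.
rewrite Tsr scaler_sumr; apply: eq_bigr => j _.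
by rewrite scalerA !mxE.
Qed.

Lemma christoffel_torsion_free y i j k : (forall z, (G z)^T = G z) ->
  christoffel y i j k = christoffel y j i k.
Proof.
move=> Gs; rewrite /christoffel; congr (_ * _); apply: eq_bigr => l _.
congr (_ * (_ - _)); first by rewrite addrC.
by congr (partial l _ y); apply/funext => z; rewrite -{1}(Gs z) mxE.
Qed.

Lemma christoffel_metric y i j l :
    (forall z, (G z)^T = G z) -> G y \in unitmx ->
  partial l (fun z => G z i j) y =
    \sum_m christoffel y l i m * G y m j + \sum_m christoffel y l j m * G y i m.
Proof.
move=> Gs GU.
have sw (a b : 'I_n) : (fun z => G z a b) = (fun z => G z b a).
  by apply/funext => z; rewrite -{1}(Gs z) mxE.
have lower (a b c : 'I_n) : \sum_m christoffel y a b m * G y c m =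
    2^-1 * (partial a (fun z => G z b c) y + partial b (fun z => G z a c) y
            - partial c (fun z => G z a b) y).
  under eq_bigr do rewrite /christoffel -mulrA.
  rewrite -mulr_sumr; congr (_ * _).
  under eq_bigr do rewrite mulr_suml.
  rewrite exchange_big /= (bigD1 c)//= [X in _ + X]big1 ?addr0.
    under eq_bigr do rewrite mulrAC [_ * G y c _]mulrC.
    have := congr1 (fun B : 'M[R]_n => B c c) (mulmxV GU).
    by rewrite !mxE eqxx -mulr_suml => ->; rewrite mul1r.
  move=> k kc; under eq_bigr do rewrite mulrAC [_ * G y c _]mulrC.
  have := congr1 (fun B : 'M[R]_n => B c k) (mulmxV GU).
  by rewrite !mxE eq_sym (negbTE kc) -mulr_suml => ->; rewrite mul0r.
under eq_bigr do rewrite -{1}(Gs y) mxE.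
rewrite !lower (sw j i).
have -> (p q r : R) :
    2^-1 * (p + q - r) + 2^-1 * (p + r - q) = p.
  lra.
by [].
Qed.

End local_geometry.

(* A smooth structure given by an atlas indexed by the points of [M], the
   chart [chart p] being defined around [p].  Tangent vectors at [p] are the
   rows of components in the preferred chart [chart p]; every tensor at [p] is
   likewise given by its components in that chart. *)
Record atlas (R : realType) (n : nat) (M : topologicalType) := Atlas {
  dom : M -> set M ;
  chart : M -> M -> 'rV[R]_n ;
  chart_inv : M -> 'rV[R]_n -> M ;
  dom_open : forall p, open (dom p) ;
  dom_self : forall p, dom p p ;
  img_open : forall p, open (chart p @` dom p) ;
  chartK : forall p q, dom p q -> chart_inv p (chart p q) = q ;
  chart_continuous : forall p q, dom p q -> {for q, continuous (chart p)} ;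
  chart_inv_continuous : forall p q, dom p q ->
    {for chart p q, continuous (chart_inv p)} ;
  transition_smooth : forall p q,
    smooth_mx (chart p @` (dom p `&` dom q))
      (fun y => chart q (chart_inv p y)) }.

Section atlas.
Context {R : realType} {n : nat} {M : topologicalType} (A : atlas R n M).

Definition img (p : M) : set 'rV[R]_n := chart A p @` dom A p.

(* Jacobian of the change from chart [p] to chart [q] at the point [m]: it maps
   the components [v] in chart [p] to the components [v *m jac p q m] in
   chart [q] *)
Definition jac (p q m : M) : 'M[R]_n :=
  \matrix_(i, j)
    partial i (fun y => chart A q (chart_inv A p y) 0 j) (chart A p m).

(* components in chart [p] of functions, vector fields, 1-forms and symmetric
   2-tensors *)
Definition fun_in (p : M) (f : M -> R) (y : 'rV[R]_n) : R :=
  f (chart_inv A p y).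

Definition vec_in (p : M) (Z : M -> 'rV[R]_n) (y : 'rV[R]_n) : 'rV[R]_n :=
  let m := chart_inv A p y in Z m *m jac m p m.

Definition form_in (p : M) (al : M -> 'cV[R]_n) (y : 'rV[R]_n) : 'cV[R]_n :=
  let m := chart_inv A p y in jac p m m *m al m.

Definition metric_in (p : M) (g : M -> 'M[R]_n) (y : 'rV[R]_n) : 'M[R]_n :=
  let m := chart_inv A p y in jac p m m *m g m *m (jac p m m)^T.

Definition Ck_fun (k : nat) (f : M -> R) := forall p, Ck k (img p) (fun_in p f).
Definition smooth_fun (f : M -> R) := forall k, Ck_fun k f.
Definition smooth_vec (Z : M -> 'rV[R]_n) :=
  forall p, smooth_mx (img p) (vec_in p Z).
Definition smooth_form (al : M -> 'cV[R]_n) :=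
  forall p, smooth_mx (img p) (form_in p al).

Definition compactly_supported (V : nmodType) (s : M -> V) :=
  exists2 K : set M, compact K & forall p, ~ K p -> s p = 0.

Definition C1_curve (gamma : R -> M) : Prop :=
  continuous gamma /\
  forall p k r, dom A p (gamma r) ->
    let c := fun h => chart A p (gamma h) 0 k in
    derivable c r 1 /\ {for r, continuous (derive1 c)}.

Definition df_in (p : M) (f : M -> R) (y : 'rV[R]_n) : 'cV[R]_n :=
  \col_i partial i (fun_in p f) y.

Definition dform (f : M -> R) (p : M) (v : 'rV[R]_n) : R :=
  (v *m df_in p f (chart A p p)) 0 0.

(* velocity in T_{gamma(r)}M, that is, in components in [chart (gamma r)] *)
Definition velocity (gamma : R -> M) (r : R) : 'rV[R]_n :=
  \row_k derive1 (fun h => chart A (gamma r) (gamma h) 0 k) r.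

End atlas.

Record metric (R : realType) (n : nat) (M : topologicalType)
    (A : atlas R n M) := Metric {
  metric_mx :> M -> 'M[R]_n ;
  metric_sym : forall p : M, (metric_mx p)^T = metric_mx p ;
  metric_pos : forall (p : M) (v : 'rV[R]_n), v != 0 ->
    0 < (v *m metric_mx p *m v^T) 0 0 ;
  metric_smooth : forall p : M, smooth_mx (img A p) (metric_in A p metric_mx) }.

Section riemannian.
Context {R : realType} {n : nat} {M : topologicalType} {A : atlas R n M}.
Variable g : metric A.
Implicit Types (p q : M) (a b c u v w : 'rV[R]_n) (f : M -> R).

Definition inner p v w : R := (v *m g p *m w^T) 0 0.
Definition tnorm p v : R := Num.sqrt (inner p v v).

Definition orthonormal_frame p (e : 'M[R]_n) := e *m g p *m e^T = 1%:M.

Definition curve_length (gamma : R -> M) : R :=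
  \int[lebesgue_measure]_(r in `[0, 1]) tnorm (gamma r) (velocity A gamma r).

Definition riemannian_dist p q : R :=
  inf [set l | exists gamma, [/\ C1_curve A gamma, gamma 0 = p, gamma 1 = q
                              & l = curve_length gamma]].

Definition complete_metric : Prop :=
  forall s : nat -> M,
    (forall eps, 0 < eps -> exists N, forall i j, (N <= i)%N -> (N <= j)%N ->
       riemannian_dist (s i) (s j) < eps) ->
    exists l : M, s @ \oo --> l.

Let G p := metric_in A p g.
Let pt p := chart A p p.

Definition hess f p v w : R := cov_form (G p) (df_in A p f) (pt p) v w.
Definition laplacian f p : R :=
  mtrace (G p) (E := R^o) (pt p) (hess f p).
Definition cov_form_at (al : M -> 'cV[R]_n) p v w : R :=
  cov_form (G p) (form_in A p al) (pt p) v w.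

Definition Cb2 f : Prop :=
  Ck_fun A 2 f /\
  exists C : R,
    [/\ forall p, `|f p| <= C,
        forall p v, `|dform A f p v| <= C * tnorm p v
      & forall p v w, `|hess f p v w| <= C * tnorm p v * tnorm p w].

Definition curv p a b c : 'rV[R]_n := lcurv (G p) (pt p) a b c.

Definition dstarR p a b : 'rV[R]_n := ldstarR (G p) (pt p) a b.

Section drift.
Variable Z : M -> 'rV[R]_n.

Definition RicZ_sharp p v : 'rV[R]_n :=
  lricZ_sharp (G p) (vec_in A p Z) (pt p) v.

Definition nabla_RicZ_sharp p a b : 'rV[R]_n :=
  cov_end (G p) (lricZ_sharp (G p) (vec_in A p Z)) (pt p) a b.

Definition generator f p : R := 2^-1 * laplacian f p + dform A f p (Z p).

End drift.
End riemannian.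

Section stochastic.
Context {R : realType} {d : measure_display} {T : measurableType d}.
Variables (F : R -> set (set T)) (P : probability T R).

Definition filtration : Prop :=
  (forall s, 0 <= s -> sigma_algebra setT (F s) /\ F s `<=` measurable) /\
  (forall r s, 0 <= r -> r <= s -> F r `<=` F s).

Definition martingale_on (t : R) (N : R -> T -> R) : Prop :=
  (forall s, 0 <= s <= t ->
     (forall C, measurable C -> F s (N s @^-1` C)) /\
     P.-integrable setT (EFin \o N s)) /\
  (forall r s, 0 <= r -> r <= s -> s <= t -> forall C, F r C ->
     (\int[P]_(w in C) (N s w)%:E = \int[P]_(w in C) (N r w)%:E)%E).

Definition brownian (n : nat) (b : 'I_n -> R -> T -> R) : Prop :=
  [/\ forall i w, b i 0 w = 0,
      forall i w, {within `[0, +oo[, continuous (fun s => b i s w)},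
      forall i s C, 0 <= s -> measurable C -> F s (b i s @^-1` C)
    & forall r s (C : set T) (D : 'I_n -> set R), 0 <= r -> r < s ->
        F r C -> (forall i, measurable (D i)) ->
        P (C `&` [set w | forall i, D i (b i s w - b i r w)]) =
        (P C * \prod_i normal_prob 0 (Num.sqrt (s - r)%R) (D i))%E].

Variable zeta : T -> \bar R.

Definition alive (s : R) : set T := [set w | (s%:E < zeta w)%E].
Definition lifetime (w : T) : set R := [set s | 0 <= s /\ alive s w].

Definition adapted (H : R -> T -> R) : Prop :=
  forall s C, 0 <= s -> measurable C -> F s (alive s `&` H s @^-1` C).

Definition continuous_alive (S : topologicalType) (H : R -> T -> S) : Prop :=
  forall w, {within lifetime w, continuous (fun s => H s w)}.

(* [p] lists the points after 0 of a subdivision of [0, s]; the integrand is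
   averaged with weights 1 - theta and theta at the left and right ends *)
Definition riemann_sum (theta : R) (H b : R -> T -> R) (p : seq R) (w : T) : R :=
  \sum_(k < size p)
    ((1 - theta) * H (nth 0 (0 :: p) k) w + theta * H (nth 0 p k) w)
    * (b (nth 0 p k) w - b (nth 0 (0 :: p) k) w).

Definition mesh_lt (eta : R) (p : seq R) : Prop :=
  forall k, (k < size p)%N -> nth 0 p k - nth 0 (0 :: p) k < eta.

(* J_s is, on {s < zeta}, the limit in probability of the Riemann sums of H
   against b over [0, s] as the mesh tends to 0.  The values of the processes
   from zeta on do not matter. *)
Definition riemann_limit theta (H b J : R -> T -> R) : Prop :=
  adapted J /\
  forall s eps delta, 0 <= s -> 0 < eps -> 0 < delta ->
    exists2 eta, 0 < eta &
      forall p, itv_partition 0 s p -> mesh_lt eta p ->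
        (P (alive s `&` [set w | (eps <= `|riemann_sum theta H b p w - J s w|)%R])
         <= delta%:E)%E.

(* These limits are the stochastic integrals for continuous adapted integrands
   (semimartingales in the Stratonovich case), the only ones used here. *)
Definition ito_integral := riemann_limit 0.
Definition stratonovich_integral := riemann_limit 2^-1.

End stochastic.

Section diffusion.
Context {R : realType} {n : nat} {M : topologicalType} {A : atlas R n M}.
Variables (g : metric A) (Z : M -> 'rV[R]_n).
Context {d : measure_display} {T : measurableType d}.
Variables (F : R -> set (set T)) (P : probability T R).

Local Notation mu := lebesgue_measure.

(* The third clause makes zeta the explosion time: X leaves every compact set
   as time tends to zeta, if zeta is finite.  The fourth one is the martingale
   problem for the generator, phi being extended by 0 to the cemetery. *)
Definition is_diffusion (x : M) (X : R -> T -> M) (zeta : T -> \bar R) : Prop :=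
  [/\ forall w, X 0 w = x /\ (0 < zeta w)%E,
      continuous_alive zeta X /\
      (forall s O, 0 <= s -> open O -> F s (alive zeta s `&` X s @^-1` O)),
      forall w, (zeta w < +oo)%E -> forall K, compact K ->
        exists2 s, lifetime zeta w s &
          forall r, s <= r -> alive zeta r w -> ~ K (X r w)
    & forall phi, smooth_fun A phi -> compactly_supported phi ->
        forall t, 0 <= t -> martingale_on F P t (fun s w =>
          (if (s%:E < zeta w)%E then phi (X s w) else 0) - phi x
          - \int[mu]_(r in `[0, s])
              (if (r%:E < zeta w)%E then generator g Z phi (X r w) else 0))].

Definition semigroup (X : M -> R -> T -> M) (zeta : M -> T -> \bar R)
    (t : R) (f : M -> R) (y : M) : R :=
  \int[P]_w (if (t%:E < zeta y w)%E then f (X y t w) else 0).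

Section path.
Variables (x : M) (X : R -> T -> M) (zeta : T -> \bar R).
(* [B] is the driving process in T_xM and [tau s w : T_xM -> T_{X_s}M, which
   sends v to v *m tau s w], the parallel transport; [e] is an orthonormal
   basis of T_xM *)
Variables (e : 'M[R]_n) (B : R -> T -> 'rV[R]_n) (tau : R -> T -> 'M[R]_n).

Definition coordB (i : 'I_n) (s : R) (w : T) : R := (B s w *m invmx e) 0 i.

Definition brownian_in_tangent : Prop := brownian F P coordB.

Definition frame (i : 'I_n) (s : R) (w : T) : 'rV[R]_n := row i e *m tau s w.

(* components in T_xM of a process with values in T_{X_s}M *)
Definition pull (V : R -> T -> 'rV[R]_n) (k : 'I_n) (s : R) (w : T) : R :=
  (V s w *m invmx (tau s w)) 0 k.

(* odX = //odB + Z(X) ds, tested on functions *)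
Definition driven_by : Prop :=
  forall f, smooth_fun A f -> compactly_supported f ->
  exists2 S : 'I_n -> R -> T -> R,
    forall i, stratonovich_integral F P zeta
      (fun s w => dform A f (X s w) (frame i s w)) (coordB i) (S i) &
    forall s, 0 <= s -> {ae P, forall w, alive zeta s w ->
      f (X s w) = f x + \sum_i S i s w
        + \int[mu]_(r in `[0, s]) dform A f (X r w) (Z (X r w))}.

(* // is stochastic parallel transport along X: for every v in T_xM and every
   1-form alpha,
     d(alpha(//v)) = (nabla_{odX} alpha)(//v),  odX = //odB + Z(X) ds *)
Definition parallel_transport : Prop :=
  (forall w, tau 0 w = 1%:M) /\
  forall al v, smooth_form A al -> compactly_supported al ->
  let Y := fun s w => (v *m tau s w *m al (X s w)) 0 0 in
  [/\ continuous_alive zeta Y, adapted F zeta Y &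
  exists2 S : 'I_n -> R -> T -> R,
    forall i, stratonovich_integral F P zeta
      (fun s w => cov_form_at g al (X s w) (frame i s w) (v *m tau s w))
      (coordB i) (S i) &
    forall s, 0 <= s -> {ae P, forall w, alive zeta s w ->
      Y s w = Y 0 w + \sum_i S i s w
        + \int[mu]_(r in `[0, s])
            cov_form_at g al (X r w) (Z (X r w)) (v *m tau r w)}].

(* DV = // d(//^{-1} V) = sum_i H_i db^i + K ds for a continuous adapted
   process V with values in T_{X_s}M and V_0 = v *)
Definition covariant_ito (V : R -> T -> 'rV[R]_n) (v : 'rV[R]_n)
    (H : 'I_n -> R -> T -> 'rV[R]_n) (K : R -> T -> 'rV[R]_n) : Prop :=
  (forall w, V 0 w = v) /\
  forall k : 'I_n,
  [/\ continuous_alive zeta (pull V k), adapted F zeta (pull V k) &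
  exists2 J : 'I_n -> R -> T -> R,
    forall i, ito_integral F P zeta (pull (H i) k) (coordB i) (J i) &
    forall s, 0 <= s -> {ae P, forall w, alive zeta s w ->
      pull V k s w = v 0 k + \sum_i J i s w
        + \int[mu]_(r in `[0, s]) pull K k r w}].

Definition solves_W (u : 'rV[R]_n) (W : R -> T -> 'rV[R]_n) : Prop :=
  covariant_ito W u (fun _ _ _ => 0)
    (fun s w => - 2^-1 *: RicZ_sharp g Z (X s w) (W s w)).

Definition solves_W' (Wu Wv W' : R -> T -> 'rV[R]_n) : Prop :=
  covariant_ito W' 0
    (fun i s w => curv g (X s w) (frame i s w) (Wu s w) (Wv s w))
    (fun s w => let y := X s w in
       - 2^-1 *: (dstarR g y (Wu s w) (Wv s w)
                  - 2 *: curv g y (Z y) (Wu s w) (Wv s w)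
                  + nabla_RicZ_sharp g Z y (Wu s w) (Wv s w))
       - 2^-1 *: RicZ_sharp g Z y (W' s w)).

End path.

(* (nabla dh)(W_s(u), W_s(v)) + (dh)(W'_s(u, v)), set to 0 on {zeta <= s} where
   the processes are undefined *)
Definition second_order (h : M -> R) (X : R -> T -> M) (zeta : T -> \bar R)
    (Wu Wv W' : R -> T -> 'rV[R]_n) (s : R) (w : T) : R :=
  if (s%:E < zeta w)%E then
    hess g h (X s w) (Wu s w) (Wv s w) + dform A h (X s w) (W' s w)
  else 0.

End diffusion.

Arguments driven_by {R n M} A Z {d T} F P x X zeta e B tau.

(* Main.v *)
Require Import Defs.
From HB Require Import structures.
From mathcomp Require Import all_boot all_order all_algebra.
From mathcomp Require Import all_classical all_reals all_analysis.
Import Order.TTheory GRing.Theory Num.Theory.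
Import numFieldNormedType.Exports.
Local Open Scope classical_set_scope.
Local Open Scope ring_scope.

(** A martingale has constant expectation, and the two sides of the formula are
the expectations of [N'_0] and [N'_t].  At time 0 the initial conditions
[X_0 = x], [W_0 = id] and [W'_0 = 0] make [N'_0] the constant
[hess (P_t f) x u v] ([second_order_start]); at time [t] the function in [N'] is
[P_0 f], which is [f] because every diffusion starts at its base point
([semigroup0]).  The analytic content (Ito's formula applied to [P_(t-s) f]
along [X], and the integrability of [N']) lies in [N'] being a martingale. *)

Section MartingaleExpectation.
Context {R : realType} {d : measure_display} {T : measurableType d}.
Context {F : R -> set (set T)} {P : probability T R}.

(** The whole space belongs to [F 0], so it is an admissible event in the
martingale property between the times 0 and [t]. *)
Lemma martingale_expectation {t : R} {N : R -> T -> R} :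
  filtration F -> 0 <= t -> martingale_on F P t N ->
  ('E_P[N t] = 'E_P[N 0%R])%E.
Proof.
move=> [Fsigma _] t0 [_ Nmart].
have [[F0 FC _] _] := Fsigma 0 (lexx 0).
have FT : F 0 setT by rewrite -(setD0 setT); exact: FC.
by rewrite unlock; exact: Nmart.
Qed.

End MartingaleExpectation.

Section Endpoints.
Context {R : realType} {n : nat} {M : topologicalType} {A : atlas R n M}.
Variable g : metric A.
Context {d : measure_display} {T : measurableType d}.

(** Time 0 precedes the explosion and the diffusion from [y] is then at [y], so
the integrand is the constant [f y], and a probability has total mass 1. *)
Lemma semigroup0 (P : probability T R) {X : M -> R -> T -> M}
    {zeta : M -> T -> \bar R} (f : M -> R) :
  (forall y w, X y 0 w = y /\ (0 < zeta y w)%E) -> semigroup P X zeta 0 f = f.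
Proof.
move=> start; apply/funext => y; rewrite /semigroup.
under eq_Rintegral => w _ do rewrite (start y w).2 (start y w).1.
rewrite Rintegral_cst// -[RHS]mulr1; congr (_ * _).
exact: (congr1 (@fine R) (probability_setT P)).
Qed.

Lemma dform0 (f : M -> R) (p : M) : dform A f p 0 = 0.
Proof. by rewrite /dform mul0mx mxE. Qed.

Lemma second_order_start (h : M -> R) {X : R -> T -> M} {zeta : T -> \bar R}
    {Wu Wv W' : R -> T -> 'rV[R]_n} {x : M} {u v : 'rV[R]_n} :
  (forall w, X 0 w = x /\ (0 < zeta w)%E) ->
  (forall w, Wu 0 w = u) -> (forall w, Wv 0 w = v) -> (forall w, W' 0 w = 0) ->
  second_order g h X zeta Wu Wv W' 0 = cst (hess g h x u v).
Proof.
move=> start Wu0 Wv0 W'0; apply/funext => w; rewrite /second_order.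
by rewrite (start w).2 (start w).1 Wu0 Wv0 W'0 dform0 addr0.
Qed.

End Endpoints.

Theorem theorem11p4 (R : realType) (n : nat) (M : topologicalType)
    (A : atlas R n M) (g : metric A) (Z : M -> 'rV[R]_n)
    (M_hausdorff : hausdorff_space M) (M_countable : @second_countable M)
    (M_connected : connected [set: M]) (M_complete : complete_metric g)
    (Z_smooth : smooth_vec A Z)
    (d : measure_display) (T : measurableType d) (P : probability T R)
    (F : R -> set (set T)) (F_filtration : filtration F)
    (X : M -> R -> T -> M) (zeta : M -> T -> \bar R)
    (X_diffusion : forall y, is_diffusion g Z F P y (X y) (zeta y))
    (f : M -> R) (f_Cb2 : Cb2 g f) (x : M) (u v : 'rV[R]_n)
    (t : R) (t_ge0 : 0 <= t)
    (e : 'M[R]_n) (e_orthonormal : orthonormal_frame g x e)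
    (B : R -> T -> 'rV[R]_n) (B_brownian : brownian_in_tangent F P e B)
    (tau : R -> T -> 'M[R]_n)
    (X_driven : driven_by A Z F P x (X x) (zeta x) e B tau)
    (tau_parallel : parallel_transport g Z F P (X x) (zeta x) e B tau)
    (W : 'rV[R]_n -> R -> T -> 'rV[R]_n)
    (W_eq : forall u1,
       solves_W g Z F P (X x) (zeta x) e B tau u1 (W u1))
    (W' : 'rV[R]_n -> 'rV[R]_n -> R -> T -> 'rV[R]_n)
    (W'_eq : forall u1 u2,
       solves_W' g Z F P (X x) (zeta x) e B tau (W u1) (W u2) (W' u1 u2))
    (X_alive : {ae P, forall w, (t%:E < zeta x w)%E})
    (N'_martingale : martingale_on F P t (fun s =>
       second_order g (semigroup P X zeta (t - s) f) (X x) (zeta x)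
         (W u) (W v) (W' u v) s)) :
  (hess g (semigroup P X zeta t f) x u v)%:E =
    ('E_P[second_order g f (X x) (zeta x) (W u) (W v) (W' u v) t])%E.
Proof.
have start y w : X y 0 w = y /\ (0 < zeta y w)%E by case: (X_diffusion y).
have := martingale_expectation F_filtration t_ge0 N'_martingale.
rewrite subrr subr0 (semigroup0 P f start) => ->.
by rewrite (second_order_start g _ (start x) (W_eq u).1 (W_eq v).1 (W'_eq u v).1)
   expectation_cst.
Qed.
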